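(* Let $\mathcal{E}$ be a locally cartesian closed category with disjoint finite coproducts, let $p\colon E\to B$ be a morphism of $\mathcal{E}$ and $n$ a natural number. Then the $n$-fibre pullback about $p$ is given by the square $$\begin{array}{ccc} n\cdot{}_{p_n}E&\xrightarrow{\ \mathrm{codiag}\ }&{}_{p_n}E\\ \downarrow&&\downarrow\\ E&\xrightarrow{\ p\ }&B\end{array}$$ obtained by pasting vertically the pullback of $\pi\colon E^{\boxtimes_Bn}\times_BE\to E^{\boxtimes_Bn}$ along $p_n\colon{}_{p_n}E\to E^{\boxtimes_Bn}$ (whose left-hand map is a composite $n\cdot{}_{p_n}E\to n\cdot E^{\boxtimes_Bn}\xrightarrow{n\cdot\delta}E^{\boxtimes_Bn}\times_BE$) on top of the pullback of $p\colon E\to B$ along the canonical map $E^{\boxtimes_Bn}\to B$.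
   Context: $\mathcal{E}$ is locally cartesian closed if it has pullbacks and each pullback functor $\Delta_p\colon\mathcal{E}/B\to\mathcal{E}/E$ has a right adjoint $\Pi_p$. $n\cdot A\cong n\times A$ is the $n$-fold copower of $A$ (with $n$ also denoting $n$ copies of the terminal object), and $\pi_2=\mathrm{codiag}\colon n\cdot A\to A$ is the codiagonal. The $n$-fibre pullback about $p\colon E\to B$ is the terminal pullback square of the form $$\begin{array}{ccc} n\times A&\xrightarrow{\pi_2}&A\\ \downarrow&&\downarrow\\ E&\xrightarrow{p}&B\end{array}$$ meaning that for any other pullback square over $p$ with top edge a projection $\pi_2\colon n\times A'\to A'$ there is a unique pullback square from $n\times A'\to A'$ to $n\times A\to A$ whose vertical pasting with the terminal one is the given square. Notation. For a map $q\colon X\to Y$, $\neg q:=\Pi_q(\mathbf{0}\to X)\in\mathcal{E}/Y$, where $\mathbf{0}$ is the initial object. Let $E^{\times n}=E\times_BE\cdots\times_BE$ be the $n$-fold fibre product of $E$ over $B$ along $p$, and $\delta_p^n\colon E\to E^{\times n}$ the $n$-fold diagonal. $E^{\boxtimes_Bn}\to E^{\times n}$ is defined to be the negation $\neg\delta_p^n$ of the $n$-fold diagonal. $\pi\colon E^{\boxtimes_Bn}\times_BE\to E^{\boxtimes_Bn}$ is the projection. $n\cdot\delta\colon n\cdot E^{\boxtimes_Bn}\to E^{\boxtimes_Bn}\times_BE$ is the map whose $i$-th component is $(e_1,\dots,e_n)\mapsto(e_1,\dots,e_n,e_i)$. Finally $p_n:=\Pi_\pi(n\cdot\delta)\colon{}_{p_n}E\to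 E^{\boxtimes_Bn}$, and the map $n\cdot{}_{p_n}E\to n\cdot E^{\boxtimes_Bn}$ is the counit component of $\Delta_\pi\dashv\Pi_\pi$, where the pullback of $\pi$ along $p_n$ is identified with the codiagonal $n\cdot{}_{p_n}E\to{}_{p_n}E$.
   Formalization: The n-fold diagonal is read as the fat diagonal (all loci e_i=e_j, i<j), so its negation is tuples with distinct entries; with E→E^{×n} the claim fails (n=1, p=id_1 in Set). A pullback square n×A'→n×A over f has left map n×f, as permuting copies would break uniqueness. *)

(* Defs.v *)
From Stdlib Require Import ProofIrrelevance.
From mathcomp Require Import all_boot.

Set Implicit Arguments.
Unset Strict Implicit.
Unset Printing Implicit Defensive.

Declare Scope cat_scope.
Delimit Scope cat_scope with cat.
Local Open Scope cat_scope.

Record category := Category {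
  obj :> Type;
  hom : obj -> obj -> Type;
  idm : forall X, hom X X;
  compm : forall X Y Z, hom Y Z -> hom X Y -> hom X Z;
  comp1m : forall X Y (f : hom X Y), compm (idm Y) f = f;
  compm1 : forall X Y (f : hom X Y), compm f (idm X) = f;
  compA : forall X Y Z W (h : hom Z W) (g : hom Y Z) (f : hom X Y),
    compm h (compm g f) = compm (compm h g) f
}.
Arguments hom {c} X Y.
Arguments idm {c} X.
Arguments compm {c X Y Z} g f.
Notation "g ∘ f" := (compm g f) (at level 40, left associativity) : cat_scope.

Definition is_iso (C : category) (X Y : C) (f : hom X Y) : Prop :=
  exists g : hom Y X, g ∘ f = idm X /\ f ∘ g = idm Y.

Definition is_mono (C : category) (X Y : C) (f : hom X Y) : Prop :=
  forall W (u v : hom W X), f ∘ u = f ∘ v -> u = v.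

Definition is_initial (C : category) (X : C) : Prop :=
  forall Y : C, exists! f : hom X Y, True.

(*        top
       P ----> X
  left |       | right
       v       v
       Y ----> Z
         bottom         *)
Definition is_pullback (C : category) (P X Y Z : C) (top : hom P X)
    (left : hom P Y) (right : hom X Z) (bottom : hom Y Z) : Prop :=
  right ∘ top = bottom ∘ left /\
  forall (W : C) (u : hom W X) (v : hom W Y), right ∘ u = bottom ∘ v ->
    exists! h : hom W P, top ∘ h = u /\ left ∘ h = v.

Record functor (C D : category) := Functor {
  fob :> C -> D;
  fmap : forall X Y : C, hom X Y -> hom (fob X) (fob Y);
  fmap1 : forall X : C, fmap (idm X) = idm (fob X);
  fmapM : forall (X Y Z : C) (g : hom Y Z) (f : hom X Y),
    fmap (g ∘ f) = fmap g ∘ fmap f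
}.
Arguments fmap {C D} _ {X Y} _.

(* [adjunction L R] is the data of [L] being left adjoint to [R]. *)
Record adjunction (C D : category) (L : functor C D) (R : functor D C) :=
  Adjunction {
  adj_unit : forall X : C, hom X (R (L X));
  adj_counit : forall Y : D, hom (L (R Y)) Y;
  adj_unit_natural : forall (X X' : C) (f : hom X X'),
    adj_unit X' ∘ f = fmap R (fmap L f) ∘ adj_unit X;
  adj_counit_natural : forall (Y Y' : D) (g : hom Y Y'),
    adj_counit Y' ∘ fmap L (fmap R g) = g ∘ adj_counit Y;
  triangle_left : forall X : C, adj_counit (L X) ∘ fmap L (adj_unit X) = idm (L X);
  triangle_right : forall Y : D, fmap R (adj_counit Y) ∘ adj_unit (R Y) = idm (R Y)
}.

Section Slice.
Variables (C : category) (B : C).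

Record slice_ob := SliceOb { sdom : C; smap : hom sdom B }.

Definition slice_hom (X Y : slice_ob) :=
  {h : hom (sdom X) (sdom Y) | smap Y ∘ h = smap X}.

Lemma slice_hom_eq (X Y : slice_ob) (f g : slice_hom X Y) :
  sval f = sval g -> f = g.
Proof.
case: f g => [f Hf] [g Hg] /= e; case: g / e Hg => Hg.
by congr exist; apply: proof_irrelevance.
Qed.

Lemma slice_id_subproof (X : slice_ob) : smap X ∘ idm (sdom X) = smap X.
Proof. exact: compm1. Qed.

Lemma slice_comp_subproof (X Y Z : slice_ob) (g : slice_hom Y Z)
  (f : slice_hom X Y) : smap Z ∘ (sval g ∘ sval f) = smap X.
Proof. by rewrite compA (svalP g) (svalP f). Qed.

Definition slice : category.
refine (@Category slice_ob slice_hom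
  (fun X => exist _ (idm (sdom X)) (slice_id_subproof X))
  (fun X Y Z g f => exist _ (sval g ∘ sval f) (slice_comp_subproof g f))
  _ _ _).
- by move=> X Y f; apply: slice_hom_eq; apply: comp1m.
- by move=> X Y f; apply: slice_hom_eq; apply: compm1.
- by move=> X Y Z W h g f; apply: slice_hom_eq; apply: compA.
Defined.

End Slice.
Arguments SliceOb {C B sdom} smap.

Section Pullback.
Variables (C : category) (X Y Z : C) (f : hom X Z) (g : hom Y Z).

(* A pullback of [f] along [g], with its universal arrow as an operation. *)
Record pullback := Pullback {
  pb_obj : C;
  pb_fst : hom pb_obj X;
  pb_snd : hom pb_obj Y;
  pb_comm : f ∘ pb_fst = g ∘ pb_snd;
  pb_pair : forall (W : C) (u : hom W X) (v : hom W Y),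
    f ∘ u = g ∘ v -> hom W pb_obj;
  pb_fst_pair : forall W (u : hom W X) (v : hom W Y) (e : f ∘ u = g ∘ v),
    pb_fst ∘ pb_pair e = u;
  pb_snd_pair : forall W (u : hom W X) (v : hom W Y) (e : f ∘ u = g ∘ v),
    pb_snd ∘ pb_pair e = v;
  pb_ext : forall W (h k : hom W pb_obj),
    pb_fst ∘ h = pb_fst ∘ k -> pb_snd ∘ h = pb_snd ∘ k -> h = k
}.

End Pullback.

Definition pullbacks (C : category) :=
  forall (X Y Z : C) (f : hom X Z) (g : hom Y Z), pullback f g.

Definition pb (C : category) (PB : pullbacks C) (X Y Z : C) (f : hom X Z)
  (g : hom Y Z) : pullback f g := PB X Y Z f g.

Section PullbackFunctor.
Variables (C : category) (PB : pullbacks C) (E B : C) (p : hom E B).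

Definition Delta_ob (X : slice B) : slice E :=
  SliceOb (pb_snd (pb PB (smap X) p)).

Lemma Delta_map_subproof (X Y : slice B) (f : hom X Y) :
  smap Y ∘ (sval f ∘ pb_fst (pb PB (smap X) p)) = p ∘ pb_snd (pb PB (smap X) p).
Proof. by rewrite compA (svalP f) pb_comm. Qed.

Definition Delta_map (X Y : slice B) (f : hom X Y) :
    hom (Delta_ob X) (Delta_ob Y) :=
  exist (fun h => smap (Delta_ob Y) ∘ h = smap (Delta_ob X))
    (pb_pair (pb PB (smap Y) p) (Delta_map_subproof f))
    (pb_snd_pair _ (Delta_map_subproof f)).

Definition Delta : functor (slice B) (slice E).
refine (@Functor (slice B) (slice E) Delta_ob Delta_map _ _).
- move=> X; apply: slice_hom_eq; apply: pb_ext => /=.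
    by rewrite pb_fst_pair compm1 comp1m.
  by rewrite pb_snd_pair compm1.
- move=> X Y Z g f; apply: slice_hom_eq; apply: pb_ext => /=.
    by rewrite pb_fst_pair compA pb_fst_pair -!compA pb_fst_pair.
  by rewrite pb_snd_pair compA !pb_snd_pair.
Defined.

End PullbackFunctor.

Record lcc_structure (C : category) := LCC {
  lcc_pb :> pullbacks C;
  Pi : forall (E B : C) (p : hom E B), functor (slice E) (slice B);
  Pi_adj : forall (E B : C) (p : hom E B), adjunction (Delta lcc_pb p) (Pi p)
}.
Arguments Pi {C} _ {E B} p.
Arguments Pi_adj {C} _ {E B} p.

Section Coproduct.
Variables (C : category) (I : Type) (F : I -> C).

Record coproduct := Coproduct {
  cop_obj : C;
  cop_in : forall i, hom (F i) cop_obj;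
  cop_desc : forall Y : C, (forall i, hom (F i) Y) -> hom cop_obj Y;
  cop_desc_in : forall Y (u : forall i, hom (F i) Y) i,
    cop_desc u ∘ cop_in i = u i;
  cop_ext : forall Y (h k : hom cop_obj Y),
    (forall i, h ∘ cop_in i = k ∘ cop_in i) -> h = k
}.

End Coproduct.
Arguments cop_in {C I F} _ i.
Arguments cop_desc {C I F} _ {Y} u.
Arguments cop_desc_in {C I F} _ {Y} u i.

Definition finite_coproducts (C : category) :=
  forall (I : finType) (F : I -> C), coproduct F.

Definition coprod (C : category) (FC : finite_coproducts C) (I : finType)
  (F : I -> C) : coproduct F := FC I F.

Definition disjoint_coproducts (C : category) (FC : finite_coproducts C) : Prop :=
  forall (I : finType) (F : I -> C),
    (forall i, is_mono (cop_in (coprod FC F) i)) /\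
    (forall i j, i <> j ->
       forall (P : C) (u : hom P (F i)) (v : hom P (F j)),
         is_pullback u v (cop_in (coprod FC F) i) (cop_in (coprod FC F) j) -> is_initial P).

Section Copowers.
Variables (C : category) (FC : finite_coproducts C).

Definition initial_ob : C := cop_obj (coprod FC (of_void C)).

Definition initial_map (X : C) : hom initial_ob X :=
  cop_desc (coprod FC (of_void C)) (fun v => match v with end).

Definition copower (n : nat) (A : C) : coproduct (fun _ : 'I_n => A) :=
  coprod FC (fun _ : 'I_n => A).

Definition codiag (n : nat) (A : C) : hom (cop_obj (copower n A)) A :=
  cop_desc (copower n A) (fun _ => idm A).

Definition copower_map (n : nat) (A A' : C) (f : hom A A') :
    hom (cop_obj (copower n A)) (cop_obj (copower n A')) :=
  cop_desc (copower n A) (fun i => cop_in (copower n A') i ∘ f).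

End Copowers.

Section NFibrePullback.
Variables (C : category) (FC : finite_coproducts C) (E B : C) (p : hom E B).
Variable n : nat.

(* The square [codiag, left, right, p] is terminal among the pullback squares
   over [p] with top edge a projection [n * A' -> A'].  A morphism between two
   such squares is a map [f : A' -> A] for which [n * f] and [f] form a pullback
   square; the map on the left is not an arbitrary map [n * A' -> n * A] over
   [f], since permuting the [n] copies would otherwise destroy uniqueness. *)
Definition is_n_fibre_pullback (A : C) (left : hom (cop_obj (copower FC n A)) E)
    (right : hom A B) : Prop :=
  is_pullback (codiag FC n A) left right p /\
  forall (A' : C) (left' : hom (cop_obj (copower FC n A')) E) (right' : hom A' B),
    is_pullback (codiag FC n A') left' right' p ->
    exists! f : hom A' A,
      is_pullback (codiag FC n A') (copower_map FC n f) f (codiag FC n A) /\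
      left ∘ copower_map FC n f = left' /\ right ∘ f = right'.

End NFibrePullback.
Arguments is_n_fibre_pullback {C} FC {E B} p n {A} left right.

Section FibrePower.
Variables (C : category) (PB : pullbacks C) (E B : C) (p : hom E B).

(* For [n = 0] this is the terminal object [idm B] of the slice over [B]. *)
Record fibre_power (n : nat) := FibrePower {
  fp_obj : C;
  fp_base : hom fp_obj B;
  fp_proj : 'I_n -> hom fp_obj E;
  fp_comm : forall i, p ∘ fp_proj i = fp_base;
  fp_tuple : forall (W : C) (b : hom W B) (e : 'I_n -> hom W E),
    (forall i, p ∘ e i = b) -> hom W fp_obj;
  fp_base_tuple : forall W (b : hom W B) (e : 'I_n -> hom W E)
    (H : forall i, p ∘ e i = b), fp_base ∘ fp_tuple H = b;
  fp_proj_tuple : forall W (b : hom W B) (e : 'I_n -> hom W E)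
    (H : forall i, p ∘ e i = b) i, fp_proj i ∘ fp_tuple H = e i;
  fp_ext : forall W (h k : hom W fp_obj), fp_base ∘ h = fp_base ∘ k ->
    (forall i, fp_proj i ∘ h = fp_proj i ∘ k) -> h = k
}.

Definition fibre_power0 : fibre_power 0.
refine (@FibrePower 0 B (idm B) (fun i => match notF (ltn_ord i) with end) _
  (fun W b e H => b) _ _ _).
- by case.
- by move=> W b e H; apply: comp1m.
- by move=> W b e H [].
- by move=> W h k; rewrite !comp1m.
Defined.

Definition fibre_powerS (n : nat) (Q : fibre_power n) : fibre_power n.+1.
pose P := pb PB (fp_base Q) p.
refine (@FibrePower n.+1 (pb_obj P) (fp_base Q ∘ pb_fst P)
  (fun i => if unlift ord_max i is Some j then fp_proj Q j ∘ pb_fst P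
            else pb_snd P) _
  (fun W b e H => pb_pair P (u := fp_tuple Q (fun j => H (lift ord_max j)))
    (v := e ord_max) (etrans (fp_base_tuple _ _) (esym (H ord_max)))) _ _ _).
- move=> i; case: unliftP => [j|] _; first by rewrite compA fp_comm.
  by rewrite -pb_comm.
- by move=> W b e H; rewrite -compA pb_fst_pair fp_base_tuple.
- move=> W b e H i; case: unliftP => [j|] ->; last exact: pb_snd_pair.
  by rewrite -compA pb_fst_pair fp_proj_tuple.
- move=> W h k Hb Hp; apply: pb_ext.
    apply: (@fp_ext _ Q) => [|j]; first by rewrite !compA.
    by have := Hp (lift ord_max j); rewrite liftK !compA.
  by have := Hp ord_max; rewrite unlift_none.
Defined.

Fixpoint fpower (n : nat) : fibre_power n :=
  if n is m.+1 then fibre_powerS (fpower m) else fibre_power0.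

End FibrePower.

Section Configurations.
Variables (C : category) (L : lcc_structure C) (FC : finite_coproducts C).

Definition neg (X Y : C) (q : hom X Y) : slice Y :=
  Pi L q (SliceOb (initial_map FC X)).

Variables (E B : C) (p : hom E B).

Definition diag : hom E (pb_obj (pb L p p)) :=
  pb_pair (pb L p p) (erefl (p ∘ idm E)).

Variable n : nat.

Let En := fpower L p n.

Lemma proj_pair_subproof (i j : 'I_n) : p ∘ fp_proj En i = p ∘ fp_proj En j.
Proof. by rewrite !fp_comm. Qed.

Definition proj_pair (i j : 'I_n) : hom (fp_obj En) (pb_obj (pb L p p)) :=
  pb_pair (pb L p p) (proj_pair_subproof i j).

Definition ord_pairs := {ij : 'I_n * 'I_n | ij.1 < ij.2}.

(* The locus [e_i = e_j] in [E^n]. *)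
Definition partial_diag (ij : ord_pairs) :
    pullback (proj_pair (val ij).1 (val ij).2) diag :=
  pb L (proj_pair (val ij).1 (val ij).2) diag.

(* The n-fold diagonal is the map into [E^n] whose negation is the object of
   n-tuples with pairwise distinct entries: it has a summand [e_i = e_j] for
   each [i < j].  The small diagonal [E -> E^n] is the case [n = 2] (see
   [n_diag2] below).  For [n = 1] or [n >= 3] the small diagonal would not
   do: its negation is the object of tuples whose entries are not all equal,
   which is initial when [n = 1], and over which [n . delta] below need not be
   monic when [n >= 3]. *)
Definition n_diag :
    hom (cop_obj (coprod FC (fun ij : ord_pairs => pb_obj (partial_diag ij)))) (fp_obj En) :=
  cop_desc (coprod FC (fun ij : ord_pairs => pb_obj (partial_diag ij)))
    (fun ij => pb_fst (partial_diag ij)).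

Definition boxtimes : slice (fp_obj En) := neg n_diag.

Definition box_proj (i : 'I_n) : hom (sdom boxtimes) E :=
  fp_proj En i ∘ smap boxtimes.

Definition box_base : hom (sdom boxtimes) B := fp_base En ∘ smap boxtimes.

Definition box_E : pullback box_base p := pb L box_base p.

Definition pi_box : hom (pb_obj box_E) (sdom boxtimes) := pb_fst box_E.

Lemma delta_subproof (i : 'I_n) : box_base ∘ idm (sdom boxtimes) = p ∘ box_proj i.
Proof. by rewrite compm1 /box_proj compA fp_comm. Qed.

Definition n_delta : hom (cop_obj (copower FC n (sdom boxtimes))) (pb_obj box_E) :=
  cop_desc (copower FC n (sdom boxtimes))
    (fun i => pb_pair box_E (delta_subproof i)).

Definition p_n : slice (sdom boxtimes) := Pi L pi_box (SliceOb n_delta).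

Definition pnE : C := sdom p_n.

(* [smap Delta_pn] is the pullback of [p_n] along [pi_box]; [Delta_pn_top] is the
   pullback of [pi_box] along [p_n]. *)
Definition Delta_pn : slice (pb_obj box_E) := Delta L pi_box p_n.

Definition Delta_pn_top : hom (sdom Delta_pn) pnE :=
  pb_fst (pb L (smap p_n) pi_box).

Definition counit_pn :
    hom (sdom Delta_pn) (cop_obj (copower FC n (sdom boxtimes))) :=
  sval (adj_counit (Pi_adj L pi_box) (SliceOb n_delta)).

End Configurations.

Lemma n_diag2 (C : category) (L : lcc_structure C) (FC : finite_coproducts C)
    (E B : C) (p : hom E B) :
  exists f : hom E _, is_iso f /\
    forall i, fp_proj (fpower L p 2) i ∘ (n_diag L FC p 2 ∘ f) = idm E.
Proof.
pose k : ord_pairs 2 := exist _ (ord0, ord_max) isT.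
have ord2 (i : 'I_2) : i = ord0 \/ i = ord_max.
  by case: i => [[|[|//]] ?]; [left|right]; apply: val_inj.
have kP ij : ij = k.
  apply: val_inj; case: ij => -[i j] /=.
  by case: (ord2 i) => ->; case: (ord2 j) => ->.
pose d := fp_tuple (fpower L p 2) (e := fun _ => idm E) (fun _ => erefl).
have dP i : fp_proj (fpower L p 2) i ∘ d = idm E by apply: fp_proj_tuple.
have e : proj_pair L p (val k).1 (val k).2 ∘ d = diag L p ∘ idm E.
  by apply: pb_ext; rewrite !compA ?pb_fst_pair ?pb_snd_pair dP compm1.
pose D := coprod FC (fun ij : ord_pairs 2 => pb_obj (partial_diag L p ij)).
pose f : hom E (cop_obj D) := cop_in D k ∘ pb_pair (partial_diag L p k) e.
pose g : hom (cop_obj D) E := cop_desc D (fun ij => pb_snd (partial_diag L p ij)).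
have gk : g ∘ cop_in D k = pb_snd (partial_diag L p k).
  exact (cop_desc_in D (fun ij => pb_snd (partial_diag L p ij)) k).
have nk : n_diag L FC p 2 ∘ cop_in D k = pb_fst (partial_diag L p k).
  exact (cop_desc_in D (fun ij => pb_fst (partial_diag L p ij)) k).
have gf : g ∘ f = idm E by rewrite /f compA gk pb_snd_pair.
have diagP : pb_snd (partial_diag L p k) = fp_proj (fpower L p 2) ord0 ∘
    pb_fst (partial_diag L p k) /\ pb_snd (partial_diag L p k) =
    fp_proj (fpower L p 2) ord_max ∘ pb_fst (partial_diag L p k).
  have c := pb_comm (partial_diag L p k).
  split; [have := congr1 (compm (pb_fst (pb L p p))) c
         |have := congr1 (compm (pb_snd (pb L p p))) c];
  by rewrite !compA ?pb_fst_pair ?pb_snd_pair comp1m.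
exists f; split; last first.
  by move=> i; rewrite /f [n_diag _ _ _ _ ∘ _]compA nk pb_fst_pair dP.
exists g; split=> //; apply: cop_ext => ij; rewrite (kP ij) comp1m.
rewrite -compA gk /f -compA -[RHS]compm1; congr (_ ∘ _).
apply: pb_ext; last by rewrite compA pb_snd_pair comp1m compm1.
rewrite compA pb_fst_pair compm1; case: diagP => d0 d1.
apply: (@fp_ext _ _ _ _ _ (fpower L p 2)) => [|i].
  rewrite -(fp_comm (fpower L p 2) ord0) -!compA; congr (_ ∘ _).
  by rewrite compA dP comp1m.
by rewrite compA dP comp1m; case: (ord2 i) => ->.
Qed.

(* Main.v *)
(** In a locally cartesian closed category pullback functors are left adjoints,
    so coproducts are universal; with disjointness this makes maps into an
    [n]-fold copower locally of the form [in_i ∘ x], with [i] determined off the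
    initial object.  Hence [n · f] is the pullback of [f] along the codiagonal,
    and [n_delta] is monic because [boxtimes] consists of tuples with distinct
    entries.  A pullback square [n · A' -> A'] over [p] is therefore the same as
    a map from [A'] to [boxtimes] (its [n] legs are distinct) together with a
    lift through [Pi], which is unique as [n_delta] is monic and exists because
    [A' ×_B E] is the copower [n · A']. *)

From mathcomp Require Import all_boot.
Require Import Defs.

Set Implicit Arguments.
Unset Strict Implicit.

Local Open Scope cat_scope.

(** * Transposition along an adjunction *)

Section Adjunction.
Variables (C D : category) (F : functor C D) (G : functor D C).
Variable adj : adjunction F G.

Definition adj_transpose (X : C) (Y : D) (g : hom (F X) Y) : hom X (G Y) :=
  fmap G g ∘ adj_unit adj X.

Definition adj_untranspose (X : C) (Y : D) (h : hom X (G Y)) : hom (F X) Y :=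
  adj_counit adj Y ∘ fmap F h.

Lemma adj_transposeK (X : C) (Y : D) (g : hom (F X) Y) :
  adj_untranspose (adj_transpose g) = g.
Proof.
rewrite /adj_untranspose /adj_transpose fmapM compA adj_counit_natural -compA.
by rewrite triangle_left compm1.
Qed.

Lemma adj_untransposeK (X : C) (Y : D) (h : hom X (G Y)) :
  adj_transpose (adj_untranspose h) = h.
Proof.
rewrite /adj_untranspose /adj_transpose fmapM -compA -adj_unit_natural compA.
by rewrite triangle_right comp1m.
Qed.

Lemma adj_untranspose_comp (X X' : C) (Y : D) (h : hom X (G Y)) (k : hom X' X) :
  adj_untranspose (h ∘ k) = adj_untranspose h ∘ fmap F k.
Proof. by rewrite /adj_untranspose fmapM compA. Qed.

End Adjunction.
Arguments adj_transpose {C D F G} adj {X Y} g.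
Arguments adj_untranspose {C D F G} adj {X Y} h.

(** * Pullback squares: joint monicity, pasting, change of apex *)

Section PullbackSquares.
Variable C : category.

Lemma pullback_is_pullback (X Y Z : C) (f : hom X Z) (g : hom Y Z)
  (P : pullback f g) : is_pullback (pb_fst P) (pb_snd P) f g.
Proof.
split=> [|W u v e]; first exact: pb_comm.
exists (pb_pair P e); split; first by rewrite pb_fst_pair pb_snd_pair.
by move=> h [hu hv]; apply: pb_ext; rewrite ?pb_fst_pair ?pb_snd_pair.
Qed.

Lemma is_pullback_ext {P X Y Z : C} {top : hom P X} {left : hom P Y}
    {right : hom X Z} {bottom : hom Y Z} (W : C) (h k : hom W P) :
  is_pullback top left right bottom ->
  top ∘ h = top ∘ k -> left ∘ h = left ∘ k -> h = k.
Proof.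
move=> [sq up] et el.
have e : right ∘ (top ∘ h) = bottom ∘ (left ∘ h) by rewrite !compA sq.
case: (up W _ _ e) => m [_ um].
by rewrite -(um h (conj erefl erefl)); apply: um.
Qed.

Lemma is_pullback_paste (P X Y Z V U : C) (top : hom P X) (left : hom P Y)
    (mid : hom Y Z) (right : hom X Z) (left' : hom Y V) (right' : hom Z U)
    (bottom : hom V U) :
  is_pullback top left right mid -> is_pullback mid left' right' bottom ->
  is_pullback top (left' ∘ left) (right' ∘ right) bottom.
Proof.
move=> pb1 pb2; split=> [|W u v e].
  by rewrite -compA (proj1 pb1) compA (proj1 pb2) compA.
rewrite -compA in e.
have [y [[yu yv] _]] := proj2 pb2 W _ _ e.
have [h [[hu hy] _]] := proj2 pb1 W _ _ (esym yu).
exists h; split=> [|k [ku kv]]; first by rewrite -compA hy.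
apply: (is_pullback_ext pb1); first by rewrite hu ku.
apply: (is_pullback_ext pb2); last by rewrite hy yv compA kv.
by rewrite !compA -(proj1 pb1) -!compA hu ku.
Qed.

Lemma is_pullback_iso (P P' X Y Z : C) (top : hom P X) (left : hom P Y)
    (right : hom X Z) (bottom : hom Y Z) (t : hom P' P) :
  is_iso t -> is_pullback top left right bottom ->
  is_pullback (top ∘ t) (left ∘ t) right bottom.
Proof.
case=> s [st ts] pbP; split=> [|W u v e].
  by rewrite !compA (proj1 pbP).
have [h [[hu hv] uh]] := proj2 pbP W u v e.
exists (s ∘ h); split.
  by rewrite -!compA ![t ∘ (s ∘ h)]compA ts comp1m.
move=> k [ku kv]; rewrite (uh (t ∘ k)) ?compA ?st ?comp1m //.
Qed.

End PullbackSquares.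

(** * Universality of coproducts *)

Section UniversalCoproducts.
Variables (C : category) (L : lcc_structure C) (FC : finite_coproducts C).

Section Decomposition.
Variables (I : finType) (F : I -> C) (W : C).
Variable v : hom W (cop_obj (coprod FC F)).

Let S := coprod FC F.
Let part i := pb L (cop_in S i) v.
Let T := coprod FC (fun i => pb_obj (part i)).
Let t : hom (cop_obj T) W := cop_desc T (fun i => pb_snd (part i)).

(* The injections of [T] transpose to a map [S -> Pi_v T] over [S], which
   transposes back to a section of [t]. *)
Let parts_section : exists s : hom W (cop_obj T),
  t ∘ s = idm W /\ forall i, s ∘ pb_snd (part i) = cop_in T i.
Proof.
pose X i : slice (cop_obj S) := SliceOb (cop_in S i).
pose X1 : slice (cop_obj S) := SliceOb (idm (cop_obj S)).
pose TW : slice W := SliceOb t.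
have ti i : t ∘ cop_in T i = pb_snd (part i)
  by exact: (cop_desc_in T (fun i => pb_snd (part i)) i).
pose inT i : hom (Delta L v (X i)) TW :=
  exist (fun h => t ∘ h = pb_snd (part i)) (cop_in T i) (ti i).
pose a i := adj_transpose (Pi_adj L v) (inT i).
pose d := cop_desc S (fun i => sval (a i)).
have dP : smap (Pi L v TW) ∘ d = idm _.
  apply: cop_ext => i; rewrite -compA cop_desc_in comp1m.
  exact: (svalP (a i)).
pose ds : hom X1 (Pi L v TW) := exist _ d dP.
pose ins i : hom (X i) X1 :=
  exist (fun h => idm _ ∘ h = cop_in S i) (cop_in S i) (comp1m _).
have dins i : ds ∘ ins i = a i.
  by apply: slice_hom_eq; exact: (cop_desc_in S (fun i => sval (a i)) i).
pose s' := adj_untranspose (Pi_adj L v) ds.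
have s'in i : s' ∘ fmap (Delta L v) (ins i) = inT i.
  by rewrite -adj_untranspose_comp dins adj_transposeK.
have e : idm (cop_obj S) ∘ v = v ∘ idm W by rewrite comp1m compm1.
(* [W] is itself the pullback of the identity of the coproduct along [v]; [j] is the comparison,
   which turns [s'] into a map out of [W]. *)
pose j := pb_pair (pb L (idm (cop_obj S)) v) e.
exists (sval s' ∘ j); split.
  by rewrite compA (svalP s') /= pb_snd_pair.
move=> i; have /= <- := congr1 sval (s'in i); rewrite -compA; congr (_ ∘ _).
apply: pb_ext; rewrite compA ?pb_fst_pair ?pb_snd_pair ?comp1m //.
by rewrite pb_comm.
Qed.

(** The section of [t] sends each part of [W] to its own injection, so copairing on the coproduct of
    the parts glues the [g i]. *)
Lemma universal_coproduct_desc (Y : C)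
    (g : forall i, hom (pb_obj (pb L (cop_in (coprod FC F) i) v)) Y) :
  exists h : hom W Y,
    forall i, h ∘ pb_snd (pb L (cop_in (coprod FC F) i) v) = g i.
Proof.
have [s [_ sP]] := parts_section.
exists (cop_desc T g ∘ s) => i.
by rewrite -compA (sP i); exact: (cop_desc_in T g i).
Qed.

(** The map [t] from the coproduct of the parts is a split epimorphism. *)
Lemma universal_coproduct_ext (Y : C) (h k : hom W Y) :
  (forall i, h ∘ pb_snd (pb L (cop_in (coprod FC F) i) v) =
             k ∘ pb_snd (pb L (cop_in (coprod FC F) i) v)) -> h = k.
Proof.
move=> hk; have [s [ts _]] := parts_section.
have ht : h ∘ t = k ∘ t.
  apply: cop_ext => i; rewrite -!compA.
  by rewrite (cop_desc_in T (fun i => pb_snd (part i)) i); apply: hk.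
by rewrite -[h]compm1 -[k]compm1 -ts !compA ht.
Qed.

End Decomposition.

(** A map to the empty coproduct cuts [P] into an empty family of parts, so there is nothing to
    compare. *)
Lemma strict_initial (P Y : C) (z : hom P (initial_ob FC)) (u w : hom P Y) :
  u = w.
Proof. by apply: (universal_coproduct_ext (v := z)) => -[]. Qed.

(** * Disjointness and squares of codiagonals *)

Section Disjoint.
Hypothesis HFC : disjoint_coproducts FC.

Lemma coproduct_disjoint (I : finType) (F : I -> C) (i j : I) (W : C)
    (x : hom W (F i)) (y : hom W (F j)) :
  i <> j -> cop_in (coprod FC F) i ∘ x = cop_in (coprod FC F) j ∘ y ->
  exists z : hom W (initial_ob FC), True.
Proof.
move=> nij e.
have [_ /(_ i j nij) disj] := HFC F.
pose P := pb L (cop_in (coprod FC F) i) (cop_in (coprod FC F) j).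
have [z _] := disj _ _ _ (pullback_is_pullback P) (initial_ob FC).
by exists (z ∘ pb_pair P e).
Qed.

(** Cutting [W] first along [u] and then along [w] leaves pieces on which both maps lie in a known
    summand. *)
Lemma eq_into_coproduct (I : finType) (F : I -> C) (W : C)
    (u w : hom W (cop_obj (coprod FC F))) :
  (forall V (s : hom V W) i j (x : hom V (F i)) (y : hom V (F j)),
     u ∘ s = cop_in (coprod FC F) i ∘ x -> w ∘ s = cop_in (coprod FC F) j ∘ y ->
     u ∘ s = w ∘ s) -> u = w.
Proof.
move=> uw; apply: (universal_coproduct_ext (v := u)) => i.
set a := pb_snd _.
apply: (universal_coproduct_ext (v := w ∘ a)) => j.
set b := pb_snd _; rewrite -!compA.
apply: (uw _ (a ∘ b) i j (pb_fst (pb L (cop_in (coprod FC F) i) u) ∘ b)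
  (pb_fst (pb L (cop_in (coprod FC F) j) (w ∘ a)))).
  by rewrite !compA pb_comm.
by rewrite compA pb_comm.
Qed.

Lemma codiag_in (n : nat) (A : C) i :
  codiag FC n A ∘ cop_in (copower FC n A) i = idm A.
Proof. exact: cop_desc_in. Qed.

Lemma copower_map_in (n : nat) (A A' : C) (f : hom A A') i :
  copower_map FC n f ∘ cop_in (copower FC n A) i =
  cop_in (copower FC n A') i ∘ f.
Proof. exact: cop_desc_in. Qed.

Lemma codiag_natural (n : nat) (A A' : C) (f : hom A A') :
  f ∘ codiag FC n A = codiag FC n A' ∘ copower_map FC n f.
Proof.
apply: cop_ext => i.
by rewrite -!compA copower_map_in codiag_in compA codiag_in compm1 comp1m.
Qed.

Lemma codiag_is_pullback (n : nat) (A A' : C) (f : hom A A') :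
  is_pullback (codiag FC n A) (copower_map FC n f) f (codiag FC n A').
Proof.
split=> [|W u v e]; first exact: codiag_natural.
pose in' := cop_in (copower FC n A').
(* Where [v] lies in the [i]-th summand, the lift has to be [u] followed by the [i]-th injection. *)
have [h hP] := universal_coproduct_desc (v := v)
  (fun i => cop_in (copower FC n A) i ∘ (u ∘ pb_snd (pb L (in' i) v))).
have [hu hv] : codiag FC n A ∘ h = u /\ copower_map FC n f ∘ h = v.
  split; apply: (universal_coproduct_ext (v := v)) => i; rewrite -compA hP /=.
    by rewrite !compA codiag_in comp1m.
  rewrite [copower_map _ _ _ ∘ _]compA copower_map_in -compA [f ∘ _]compA e.
  rewrite -[codiag _ _ _ ∘ _ ∘ _]compA -pb_comm.
  by rewrite [codiag _ _ _ ∘ _]compA codiag_in comp1m.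
exists h; split=> // k [ku kv].
apply: eq_into_coproduct => V s i j x y hx ky.
have ux : u ∘ s = x by rewrite -hu -compA hx compA codiag_in comp1m.
have uy : u ∘ s = y by rewrite -ku -compA ky compA codiag_in comp1m.
have vx : v ∘ s = cop_in (copower FC n A') i ∘ (f ∘ x).
  by rewrite -hv -compA hx !compA copower_map_in.
have vy : v ∘ s = cop_in (copower FC n A') j ∘ (f ∘ y).
  by rewrite -kv -compA ky !compA copower_map_in.
(* If [i] and [j] differ, [v ∘ s] lies in two summands at once, so [V] maps to the initial object
   and all parallel maps out of it agree. *)
rewrite hx ky -ux -uy; case: (eqVneq i j) => [-> //|/eqP nij].
have [z _] := coproduct_disjoint nij (etrans (esym vx) vy).
exact: (strict_initial z).
Qed.

End Disjoint.
End UniversalCoproducts.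

(** * Negation of a map *)

Section NFibrePullbacks.
Variables (C : category) (L : lcc_structure C) (FC : finite_coproducts C).
Hypothesis HFC : disjoint_coproducts FC.

(* [neg q] is subterminal in the slice, because maps into it transpose to maps
   into the initial object. *)
Lemma neg_is_mono (X Y : C) (q : hom X Y) : is_mono (smap (neg L FC q)).
Proof.
move=> W u w e.
pose S : slice Y := SliceOb (smap (neg L FC q) ∘ u).
pose u' : hom S (neg L FC q) :=
  exist (fun h => smap (neg L FC q) ∘ h = smap S) u erefl.
pose w' : hom S (neg L FC q) :=
  exist (fun h => smap (neg L FC q) ∘ h = smap S) w (esym e).
suff /(congr1 sval) : u' = w' by [].
rewrite -(adj_untransposeK (Pi_adj L q) u') -(adj_untransposeK (Pi_adj L q) w').
congr adj_transpose; apply: slice_hom_eq.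
exact: (strict_initial L (sval (adj_untranspose (Pi_adj L q) u'))).
Qed.

(** By strictness, [z] is automatically a map over [X]; its transpose is the lift. *)
Lemma neg_lift (X Y W : C) (q : hom X Y) (t : hom W Y)
    (z : hom (pb_obj (pb L t q)) (initial_ob FC)) :
  exists b : hom W (sdom (neg L FC q)), smap (neg L FC q) ∘ b = t.
Proof.
pose S : slice Y := SliceOb t.
pose Z : slice X := SliceOb (initial_map FC X).
have zP : smap Z ∘ z = smap (Delta L q S) by exact: (strict_initial L z).
pose zs : hom (Delta L q S) Z := exist _ z zP.
pose b := adj_transpose (Pi_adj L q) zs.
by exists (sval b); apply: (svalP b).
Qed.

(** The pair of [b] and [x] is a map to the pullback of [neg q] along [q], which the counit sends to
    the initial object. *)
Lemma neg_disjoint (X Y W : C) (q : hom X Y)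
    (b : hom W (sdom (neg L FC q))) (x : hom W X) :
  smap (neg L FC q) ∘ b = q ∘ x -> exists z : hom W (initial_ob FC), True.
Proof.
move=> e.
exists (sval (adj_counit (Pi_adj L q) (SliceOb (initial_map FC X))) ∘
  pb_pair (pb L (smap (neg L FC q)) q) e).
by [].
Qed.

(** * Configurations of pairwise distinct points *)

Variables (E B : C) (p : hom E B) (n : nat).

Let En := fpower L p n.
Let box := boxtimes L FC p n.
Let boxE := box_E L FC p n.
Let Q := pnE L FC p n.
Let q : hom Q (sdom box) := smap (p_n L FC p n).
Let delta := n_delta L FC p n.
Let ndiag := n_diag L FC p n.

Lemma n_diag_in (ij : ord_pairs n) :
  ndiag ∘ cop_in (coprod FC (fun ij => pb_obj (partial_diag L p ij))) ij =
  pb_fst (partial_diag L p ij).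
Proof. exact: (cop_desc_in _ (fun ij => pb_fst (partial_diag L p ij)) ij). Qed.

Lemma partial_diag_proj (ij : ord_pairs n) :
  fp_proj En (val ij).1 ∘ pb_fst (partial_diag L p ij) =
  fp_proj En (val ij).2 ∘ pb_fst (partial_diag L p ij).
Proof.
have c := pb_comm (partial_diag L p ij).
have c1 := congr1 (compm (pb_fst (pb L p p))) c.
have c2 := congr1 (compm (pb_snd (pb L p p))) c.
rewrite !compA !pb_fst_pair in c1; rewrite !compA !pb_snd_pair in c2.
exact: etrans c1 (esym c2).
Qed.

Lemma partial_diag_lift (W : C) (t : hom W (fp_obj En)) (ij : ord_pairs n) :
  fp_proj En (val ij).1 ∘ t = fp_proj En (val ij).2 ∘ t ->
  exists x : hom W (pb_obj (partial_diag L p ij)),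
    pb_fst (partial_diag L p ij) ∘ x = t.
Proof.
move=> e.
have c : proj_pair L p (val ij).1 (val ij).2 ∘ t =
    diag L p ∘ (fp_proj En (val ij).1 ∘ t).
  apply: pb_ext; rewrite !compA ?pb_fst_pair ?pb_snd_pair comp1m //.
by exists (pb_pair (partial_diag L p ij) c); rewrite pb_fst_pair.
Qed.

(** Equal entries [i] and [j] put the tuple in a summand of the domain of [n_diag], against the
    negation. *)
Lemma box_proj_disjoint (W : C) (b : hom W (sdom box)) (i j : 'I_n) :
  i <> j -> box_proj L FC p i ∘ b = box_proj L FC p j ∘ b ->
  exists z : hom W (initial_ob FC), True.
Proof.
(* The summands of that domain are indexed by pairs with [i < j] only. *)
wlog lt_ij : i j / i < j.
  move=> H nij e; case: (ltngtP i j) => [lt|lt|/val_inj //].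
    exact: H lt nij e.
  by apply: (H j i lt) => // /esym.
move=> _; rewrite -!compA => e.
have [x xP] := @partial_diag_lift W (smap box ∘ b) (exist _ (i, j) lt_ij) e.
apply: (@neg_disjoint _ _ _ ndiag b (cop_in (coprod FC _) _ ∘ x)).
by rewrite compA n_diag_in xP.
Qed.

Lemma delta_in i :
  delta ∘ cop_in (copower FC n (sdom box)) i =
  pb_pair boxE (delta_subproof L FC p i).
Proof.
exact: (cop_desc_in (copower FC n (sdom box))
  (fun i => pb_pair boxE (delta_subproof L FC p i)) i).
Qed.

Lemma pi_delta : pi_box L FC p n ∘ delta = codiag FC n (sdom box).
Proof. by apply: cop_ext => i; rewrite -compA delta_in codiag_in pb_fst_pair. Qed.

Lemma delta_proj i (W : C) (x : hom W (sdom box)) :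
  pb_snd boxE ∘ (delta ∘ (cop_in (copower FC n (sdom box)) i ∘ x)) =
  box_proj L FC p i ∘ x.
Proof. by rewrite (compA delta) delta_in compA pb_snd_pair. Qed.

Lemma n_delta_is_mono : is_mono delta.
Proof.
move=> W u w e; apply: (eq_into_coproduct L) => V s i j x y ux wy.
have es : delta ∘ (cop_in (copower FC n (sdom box)) i ∘ x) =
    delta ∘ (cop_in (copower FC n (sdom box)) j ∘ y).
  have := congr1 (fun h => h ∘ s) e.
  by rewrite /= -!compA => {}e; rewrite -[cop_in _ i ∘ x]ux -[cop_in _ j ∘ y]wy.
have xy : x = y.
  have := congr1 (compm (pi_box L FC p n)) es.
  by rewrite !compA pi_delta !codiag_in !comp1m.
(* The coordinate in [E] now says that entries [i] and [j] of the configuration [x] agree. *)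
have := congr1 (compm (pb_snd boxE)) es.
rewrite !delta_proj -xy => ep.
rewrite ux wy -xy; case: (eqVneq i j) => [-> //|/eqP nij].
by have [z _] := box_proj_disjoint nij ep; apply: (strict_initial L z).
Qed.

(* [Pi] is a right adjoint, so it preserves the subterminality of [n_delta]. *)
Lemma p_n_is_mono : is_mono q.
Proof.
move=> W u w e.
pose S : slice (sdom box) := SliceOb (q ∘ u).
pose u' : hom S (p_n L FC p n) := exist (fun h => q ∘ h = smap S) u erefl.
pose w' : hom S (p_n L FC p n) := exist (fun h => q ∘ h = smap S) w (esym e).
suff /(congr1 sval) : u' = w' by [].
set adj := Pi_adj L (pi_box L FC p n).
rewrite -(adj_untransposeK adj u') -(adj_untransposeK adj w').
congr adj_transpose; apply: slice_hom_eq; apply: n_delta_is_mono.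
by rewrite (svalP (adj_untranspose adj u')) (svalP (adj_untranspose adj w')).
Qed.

(** * The pullback of the projection along [p_n] as a copower *)

Let pbQ := pb L q (pi_box L FC p n).

Lemma theta_subproof :
  q ∘ codiag FC n Q = pi_box L FC p n ∘ (delta ∘ copower_map FC n q).
Proof. by rewrite compA pi_delta codiag_natural. Qed.

Definition theta : hom (cop_obj (copower FC n Q)) (sdom (Delta_pn L FC p n)) :=
  pb_pair pbQ theta_subproof.

Lemma delta_counit : delta ∘ counit_pn L FC p n = pb_snd pbQ.
Proof. exact: (svalP (adj_counit (Pi_adj L (pi_box L FC p n)) (SliceOb delta))). Qed.

Lemma top_theta : Delta_pn_top L FC p n ∘ theta = codiag FC n Q.
Proof. exact: pb_fst_pair. Qed.

Lemma counit_theta : counit_pn L FC p n ∘ theta = copower_map FC n q.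
Proof.
by apply: n_delta_is_mono; rewrite compA delta_counit pb_snd_pair.
Qed.

(** Since [pi_box ∘ delta] is the codiagonal, the counit maps the pullback of [pi_box] along [q]
    into the pullback of the codiagonal along [q], which is the copower of [Q]; this is the
    inverse. *)
Lemma theta_is_iso : is_iso theta.
Proof.
have pbc := codiag_is_pullback L HFC n q.
have e : q ∘ Delta_pn_top L FC p n =
    codiag FC n (sdom box) ∘ counit_pn L FC p n.
  by rewrite -pi_delta -compA delta_counit (pb_comm pbQ).
have [psi [[top_psi map_psi] _]] := proj2 pbc _ _ _ e.
exists psi; split.
  apply: (is_pullback_ext pbc); rewrite compA compm1.
    by rewrite top_psi top_theta.
  by rewrite map_psi counit_theta.
apply: (@pb_ext _ _ _ _ _ _ pbQ); rewrite compA compm1.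
  by rewrite -[pb_fst pbQ ∘ theta]/(Delta_pn_top L FC p n ∘ theta) top_theta.
by rewrite pb_snd_pair -compA map_psi delta_counit.
Qed.

(** * The pasted square and its terminality *)

Let left := pb_snd boxE ∘ (delta ∘ (counit_pn L FC p n ∘ theta)).
Let right := box_base L FC p n ∘ q.

Lemma n_fibre_square_is_pullback : is_pullback (codiag FC n Q) left right p.
Proof.
rewrite /left [delta ∘ _]compA delta_counit [pb_snd boxE ∘ _]compA -top_theta.
apply: is_pullback_iso; first exact: theta_is_iso.
exact: (is_pullback_paste (pullback_is_pullback pbQ) (pullback_is_pullback boxE)).
Qed.

Lemma left_in (i : 'I_n) :
  left ∘ cop_in (copower FC n Q) i = box_proj L FC p i ∘ q.
Proof.
by rewrite /left counit_theta -!compA copower_map_in delta_proj compA.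
Qed.

(** The legs of the square form a tuple over [B]. They are pairwise disjoint because the square is a
    pullback, so the pullback of the tuple along [n_diag] maps to the initial object and [neg_lift]
    applies. *)
Lemma box_lift (A : C) (l : hom (cop_obj (copower FC n A)) E) (r : hom A B) :
  is_pullback (codiag FC n A) l r p ->
  exists b : hom A (sdom box), box_base L FC p n ∘ b = r /\
    forall i, box_proj L FC p i ∘ b = l ∘ cop_in (copower FC n A) i.
Proof.
move=> pbA.
have H i : p ∘ (l ∘ cop_in (copower FC n A) i) = r.
  by rewrite compA -(proj1 pbA) -compA codiag_in compm1.
pose t := fp_tuple En (e := fun i => l ∘ cop_in (copower FC n A) i) H.
pose P := pb L t ndiag.
have proj_t i : fp_proj En i ∘ t = l ∘ cop_in (copower FC n A) i.
  exact: fp_proj_tuple.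
suff [z _] : exists z : hom (pb_obj P) (initial_ob FC), True.
  have [b bt] := neg_lift z; exists b.
  split=> [|i]; rewrite -compA bt; [exact: fp_base_tuple|exact: proj_t].
(* Maps to the initial object can be found separately over each summand [e_i = e_j] and then
   glued. *)
suff /fin_all_exists [z _] : forall ij : ord_pairs n,
    exists z : hom (pb_obj (pb L (cop_in (coprod FC
      (fun ij => pb_obj (partial_diag L p ij))) ij) (pb_snd P)))
    (initial_ob FC), True.
  by have [h _] := universal_coproduct_desc z; exists h.
move=> ij; set R := pb L _ (pb_snd P).
pose a := pb_fst P ∘ pb_snd R.
have ta : t ∘ a = pb_fst (partial_diag L p ij) ∘ pb_fst R.
  by rewrite compA (pb_comm P) -compA -(pb_comm R) compA n_diag_in.
have nij : (val ij).1 <> (val ij).2.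
  by move=> e; have := valP ij; rewrite /= e ltnn.
apply: (coproduct_disjoint L HFC (x := a) (y := a) nij).
(* The two injections of [a] agree under the codiagonal and, as entries [i] and [j] coincide here,
   also under [l]. *)
apply: (is_pullback_ext pbA); rewrite !compA; first by rewrite !codiag_in.
by rewrite -!proj_t -!compA ta !compA partial_diag_proj.
Qed.

Lemma n_fibre_square_terminal : is_n_fibre_pullback FC p n left right.
Proof.
split=> [|A l r pbA]; first exact: n_fibre_square_is_pullback.
have [b [base_b proj_b]] := box_lift pbA.
pose S : slice (sdom box) := SliceOb b.
pose D := pb L b (pi_box L FC p n).
have sqD : p ∘ (pb_snd boxE ∘ pb_snd D) = r ∘ pb_fst D.
  by rewrite compA -(pb_comm boxE) -compA -(pb_comm D) compA base_b.
(* [D] is the pullback of [A] and [E] over [B], so the given square yields a map from it to the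
   copower of [A]. *)
have [m [[mr ml] _]] := proj2 pbA _ _ _ (esym sqD).
(* Hence the projection from [D] factors through [delta], which is the datum that transposes to a
   map into [p_n]. *)
have mP : delta ∘ (copower_map FC n b ∘ m) = pb_snd D.
  apply: (@pb_ext _ _ _ _ _ _ boxE).
    rewrite compA -[pb_fst boxE]/(pi_box L FC p n) pi_delta compA.
    by rewrite -codiag_natural -compA mr (pb_comm D).
  rewrite -ml !compA; congr (_ ∘ _); apply: cop_ext => i.
  by rewrite -!compA copower_map_in delta_proj proj_b.
pose g : hom (Delta L (pi_box L FC p n) S) (SliceOb delta) :=
  exist (fun h => delta ∘ h = pb_snd D) (copower_map FC n b ∘ m) mP.
pose f := adj_transpose (Pi_adj L (pi_box L FC p n)) g.
have qf : q ∘ sval f = b by exact: (svalP f).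
exists (sval f); split.
  split; first exact: codiag_is_pullback.
  split; last by rewrite -compA qf.
  apply: cop_ext => i.
  by rewrite -compA copower_map_in compA left_in -compA qf proj_b.
(* Both [q] and the inclusion of [boxtimes] are monic, so [f'] is determined by its base point and
   its entries. *)
move=> f' [_ [left_f' right_f']]; apply: p_n_is_mono; rewrite qf.
apply: neg_is_mono; apply: (@fp_ext _ _ _ _ _ En) => [|i]; rewrite !compA.
  by rewrite -[fp_base En ∘ _]/(box_base L FC p n) base_b right_f'.
rewrite -[fp_proj En i ∘ _]/(box_proj L FC p i) proj_b -left_in.
by rewrite -left_f' -!compA copower_map_in.
Qed.

End NFibrePullbacks.

Unset Implicit Arguments.

Theorem proposition4p2p8 (C : category) (L : lcc_structure C)
    (FC : finite_coproducts C) (HFC : disjoint_coproducts FC)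
    (E B : C) (p : hom E B) (n : nat) :
  exists theta : hom (cop_obj (copower FC n (pnE L FC p n)))
                     (sdom (Delta_pn L FC p n)),
    is_iso theta /\
    Delta_pn_top L FC p n ∘ theta = codiag FC n (pnE L FC p n) /\
    counit_pn L FC p n ∘ theta = copower_map FC n (smap (p_n L FC p n)) /\
    is_n_fibre_pullback FC p n
      (pb_snd (box_E L FC p n) ∘ (n_delta L FC p n ∘ (counit_pn L FC p n ∘ theta)))
      (box_base L FC p n ∘ smap (p_n L FC p n)).
Proof.
exists (theta L FC p n); split; first exact: theta_is_iso.
split; first exact: top_theta.
split; first exact: counit_theta.
exact: n_fibre_square_terminal.
Qed.
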